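(* Let $m,n \geq 4$ be integers and let $G=G_{n,m}$ be the $n \times m$ grid graph. For every connected dominating set $S$ of $G$, \[ |S| \geq \left\lceil \frac{mn+2\left\lceil \frac{\min \{m,n\}}{3}\right\rceil}{3} \right\rceil . \] Equivalently, the connected domination number satisfies $\gamma_c(G_{n,m}) \geq \left\lceil \frac{mn+2\lceil \min\{m,n\}/3\rceil}{3}\right\rceil$.
   Context: The grid graph $G_{n,m}$ has vertex set $\{1,\dots,n\}\times\{1,\dots,m\}$, with $(i_1,j_1)$ and $(i_2,j_2)$ adjacent iff $|i_1-i_2|+|j_1-j_2|=1$. A connected dominating set of a graph $G=(V,E)$ is a set $S \subseteq V$ such that the induced subgraph $G[S]$ is connected and every vertex of $V$ is in $S$ or adjacent to a vertex of $S$. $\gamma_c(G)$ is the minimum size of a connected dominating set. *)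

(* Defs.v *)
From mathcomp Require Import all_boot all_order all_algebra.

Set Implicit Arguments.
Unset Strict Implicit.
Unset Printing Implicit Defensive.

Import Order.TTheory GRing.Theory Num.Theory.

(* A finite simple graph is a finType of vertices with a symmetric and
   irreflexive adjacency relation. *)

Definition induced (V : finType) (e : rel V) (S : {set V}) : rel V :=
  [rel x y | [&& x \in S, y \in S & e x y]].

Definition induced_connected (V : finType) (e : rel V) (S : {set V}) : bool :=
  [forall x in S, forall y in S, connect (induced e S) x y].

Definition dominating (V : finType) (e : rel V) (S : {set V}) : bool :=
  [forall v, (v \in S) || [exists u in S, e v u]].

Definition connected_dominating (V : finType) (e : rel V) (S : {set V}) : bool :=
  induced_connected e S && dominating e S.

(* The neutral element #|V| bounds every #|S|, so this is the true minimum
   whenever a connected dominating set exists, e.g. in any connected graph. *)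
Definition connected_domination_number (V : finType) (e : rel V) : nat :=
  \big[minn/#|V|]_(S : {set V} | connected_dominating e S) #|S|.

(* Coordinates are numbered from 0 instead of 1; `|a - b| is the distance in
   the integers, not truncated subtraction. *)
Definition grid (n m : nat) : rel ('I_n * 'I_m) :=
  [rel x y : 'I_n * 'I_m | `|x.1 - y.1|%N + `|x.2 - y.2|%N == 1].

Lemma grid_sym n m : symmetric (@grid n m).
Proof.
by move=> x y; rewrite /grid /= (distnC x.1) (distnC x.2).
Qed.

Lemma grid_irrefl n m : irreflexive (@grid n m).
Proof. by move=> x; rewrite /grid /= !distnn. Qed.

(* Main.v *)
Require Import Defs.
From mathcomp Require Import all_boot all_order all_algebra.
From mathcomp Require Import zify ring lra.

Set Implicit Arguments.
Unset Strict Implicit.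
Unset Printing Implicit Defensive.

Import Order.TTheory GRing.Theory Num.Theory.
Local Open Scope ring_scope.

(* Let k = |S|, e = number of edges of G[S] and b = number of pairs (cell of S,
   side of that cell on the border of the grid).  Counting the neighbours of S
   outside S gives
     4 k - b - 2 e = sum over v outside S of deg_S v,
   where every term is at least 1.  The boundary of the polyomino S has a reflex
   corner for each 2 x 2 window containing exactly three cells of S, and such a
   window raises deg_S of its missing cell, except that a hole (a missing cell
   whose eight neighbours are in S) has degree 4 and four windows.  Gauss-Bonnet
   counts reflex corners: if W is the total number of corners, then
     W = 2 #reflex + 4 (k - e + #full windows).
   As e >= k - 1 + #full + #holes by connectedness, 3 k >= m n + 2 t follows from
     W + 4 #full + 2 b >= 4 t + 8.
   Here b >= 4 by domination of the four corners of the grid.  For W, let C_i be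
   the total variation of the difference of the indicators of rows i and i + 1, so
   that W is the sum of the C_i.  If C_i + C_(i+1) + C_(i+2) < 4 somewhere, then
   some row is repeated and dominates itself; each of its runs bounds two vertical
   sides of S and its other cells start full windows, so t can be its number of
   cells, which is at least m / 3.  Otherwise summing C_i over disjoint triples of
   consecutive indices gives t >= n / 3, up to a discussion of the first and last
   rows when n = 1 mod 3. *)

(** * Double sums over rectangles and their index shifts *)

Definition dsum (a b : nat) (F : nat -> nat -> int) : int :=
  \sum_(0 <= i < a) \sum_(0 <= j < b) F i j.

Lemma dsumD a b F G :
  dsum a b (fun i j => F i j + G i j) = dsum a b F + dsum a b G.
Proof. by rewrite /dsum -big_split; apply: eq_bigr => i _; rewrite big_split. Qed.

Lemma dsumZ a b c F : dsum a b (fun i j => c * F i j) = c * dsum a b F.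
Proof. by rewrite /dsum mulr_sumr; apply: eq_bigr => i _; rewrite mulr_sumr. Qed.

Lemma dsumB a b F G :
  dsum a b (fun i j => F i j - G i j) = dsum a b F - dsum a b G.
Proof.
rewrite -[- dsum a b G]mulN1r -dsumZ -dsumD.
by apply: eq_bigr => i _; apply: eq_bigr => j _; rewrite mulN1r.
Qed.

Lemma eq_dsum a b F G : F =2 G -> dsum a b F = dsum a b G.
Proof. by move=> FG; apply: eq_bigr => i _; apply: eq_bigr => j _; apply: FG. Qed.

Lemma ler_dsum a b F G :
  (forall i j, (i < a)%N -> (j < b)%N -> F i j <= G i j) -> dsum a b F <= dsum a b G.
Proof.
move=> FG; rewrite /dsum !big_mkord; apply: ler_sum => i _.
by rewrite !big_mkord; apply: ler_sum => j _; apply: FG.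
Qed.

Lemma dsum_exchange a b F : dsum a b F = \sum_(0 <= j < b) \sum_(0 <= i < a) F i j.
Proof. exact: exchange_big_nat. Qed.

Lemma dsumSl a b F :
  dsum a.+1 b F = \sum_(0 <= j < b) F 0 j + dsum a b (fun i j => F i.+1 j).
Proof. by rewrite /dsum big_nat_recl. Qed.

Lemma dsumSr a b F : dsum a.+1 b F = dsum a b F + \sum_(0 <= j < b) F a j.
Proof. by rewrite /dsum big_nat_recr. Qed.

Lemma dsum_cSl a b F :
  dsum a b.+1 F = \sum_(0 <= i < a) F i 0 + dsum a b (fun i j => F i j.+1).
Proof. by rewrite /dsum -big_split; apply: eq_bigr => i _; rewrite big_nat_recl. Qed.

Lemma dsum_cSr a b F : dsum a b.+1 F = dsum a b F + \sum_(0 <= i < a) F i b.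
Proof. by rewrite /dsum -big_split; apply: eq_bigr => i _; rewrite big_nat_recr. Qed.

Lemma dsum_rowl a b F : (forall j, F 0 j = 0) ->
  dsum a.+1 b F = dsum a b (fun i j => F i.+1 j).
Proof. by move=> F0; rewrite dsumSl big1_seq ?add0r. Qed.

Lemma dsum_rowr a b F : (forall j, F a j = 0) -> dsum a.+1 b F = dsum a b F.
Proof. by move=> F0; rewrite dsumSr big1_seq ?addr0. Qed.

Lemma dsum_coll a b F : (forall i, F i 0 = 0) ->
  dsum a b.+1 F = dsum a b (fun i j => F i j.+1).
Proof. by move=> F0; rewrite dsum_cSl big1_seq ?add0r. Qed.

Lemma dsum_colr a b F : (forall i, F i b = 0) -> dsum a b.+1 F = dsum a b F.
Proof. by move=> F0; rewrite dsum_cSr big1_seq ?addr0. Qed.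

Lemma sum_ge_seq b (F : nat -> int) (s : seq nat) :
  (forall j, 0 <= F j) -> uniq s -> all (fun j => j < b)%N s ->
  \sum_(j <- s) F j <= \sum_(0 <= j < b) F j.
Proof.
move=> F0 us /allP sb; rewrite [leRHS](bigID [in s]) /= -[leLHS]addr0.
apply: lerD; last exact: sumr_ge0.
rewrite -[leRHS]big_filter; rewrite le_eqVlt; apply/orP; left; apply/eqP.
  apply: perm_big; apply: uniq_perm => //.
  by rewrite filter_uniq ?iota_uniq.
move=> j; rewrite mem_filter mem_index_iota andbC /=.
by case: (boolP (j \in s)) => [/sb ->|]; rewrite ?andbF.
Qed.

(** * Total variation of integer sequences *)

Section TotalVariation.
Variable D : nat -> int.

Lemma tv_ge p q : (p <= q)%N ->
  `|D q - D p| <= \sum_(p <= j < q) `|D j.+1 - D j|.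
Proof.
by move=> pq; rewrite -telescope_sumr //; apply: ler_norm_sum.
Qed.

(** Triangle inequality on the four segments cut by three probes. As [D] vanishes at both ends, the
    outer segments contribute [|D p|] and [|D r|]. *)
Lemma tv_ge3 M p q r : D 0 = 0 -> D M = 0 -> (p <= q)%N -> (q <= r)%N -> (r <= M)%N ->
  `|D p| + `|D q - D p| + `|D r - D q| + `|D r| <= \sum_(0 <= j < M) `|D j.+1 - D j|.
Proof.
move=> D0 DM pq qr rM.
rewrite (big_cat_nat (n := p)) ?(leq_trans pq) ?(leq_trans qr) //=.
rewrite (big_cat_nat (m := p) (n := q)) ?(leq_trans qr) //=.
rewrite (big_cat_nat (m := q) (n := r)) //=.
have tv0 := tv_ge (leq0n p); have tvM := tv_ge rM.
rewrite D0 subr0 in tv0; rewrite DM sub0r normrN in tvM.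
by rewrite !addrA; do !apply: lerD => //; apply: tv_ge.
Qed.

Lemma tv_ge1 M p : D 0 = 0 -> D M = 0 -> (p <= M)%N ->
  2 * `|D p| <= \sum_(0 <= j < M) `|D j.+1 - D j|.
Proof. by move=> D0 DM pM; have := tv_ge3 D0 DM (leqnn p) (leqnn p) pM; lia. Qed.

End TotalVariation.

Lemma dsum_shift_row a b F : (forall j, F 0 j = 0) -> (forall j, F a.+1 j = 0) ->
  dsum a.+1 b (fun i j => F i.+1 j) = dsum a.+1 b F.
Proof. by move=> F0 Fa; rewrite dsum_rowr // -dsum_rowl. Qed.

Lemma dsum_shift_col a b F : (forall i, F i 0 = 0) -> (forall i, F i b.+1 = 0) ->
  dsum a b.+1 (fun i j => F i j.+1) = dsum a b.+1 F.
Proof. by move=> F0 Fb; rewrite dsum_colr // -dsum_coll. Qed.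

(* [f i j] says that cell (i, j) belongs to S, with rows 1..n and columns 1..m;
   row and column 0, n + 1, m + 1 are empty padding. *)
Section PaddedGrid.
Variables (n m : nat) (f : nat -> nat -> bool).
Hypothesis fP : forall i j, f i j -> (0 < i <= n)%N && (0 < j <= m)%N.

Let g i j : int := (f i j : nat)%:Z.

Definition full i j := [&& f i j, f i j.+1, f i.+1 j & f i.+1 j.+1].

Definition hole i j :=
  [&& ~~ f i.+1 j.+1, f i j, f i j.+1, f i j.+2, f i.+1 j, f i.+1 j.+2,
      f i.+2 j, f i.+2 j.+1 & f i.+2 j.+2].

Definition three_of_window i j :=
  (f i j + f i j.+1 + f i.+1 j + f i.+1 j.+1 == 3)%N.

(* The absolute mixed difference on a 2 x 2 window is the number of corners of the
   boundary of S at its centre: 1 for one or three cells, 2 for a diagonal pair. *)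
Definition corners i j : int := `|(g i j.+1 - g i.+1 j.+1) - (g i j - g i.+1 j)|.

Let Z F := dsum n.+1 m.+1 (fun i j => (F i j : bool)%:Z).

Definition cells : int := dsum n m (fun i j => g i.+1 j.+1).
Definition edges : int :=
  Z (fun i j => f i j && f i j.+1) + Z (fun i j => f i j && f i.+1 j).
Definition border : int :=
  \sum_(0 <= j < m) (g 1 j.+1 + g n j.+1) + \sum_(0 <= i < n) (g i.+1 1 + g i.+1 m).
Definition turning : int := dsum n.+1 m.+1 corners.

(** * Corner count and outer degree count *)

Lemma f_row0 j : f 0 j = false. Proof. by apply/negP => /fP; lia. Qed.
Lemma f_rowN j : f n.+1 j = false. Proof. by apply/negP => /fP; lia. Qed.
Lemma f_col0 i : f i 0 = false. Proof. by apply/negP => /fP; lia. Qed.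
Lemma f_colN i : f i m.+1 = false. Proof. by apply/negP => /fP; lia. Qed.
Let f_pad := (f_row0, f_rowN, f_col0, f_colN).

Lemma cellsE : cells = dsum n.+1 m.+1 g.
Proof. by rewrite dsum_rowl ?dsum_coll // => i; rewrite /g f_pad. Qed.

(** An identity on each window, checked on its 16 fillings, is summed over all windows. The padding
    puts every cell in four windows and every edge in two. *)
Lemma turningE :
  turning = 2 * Z three_of_window + 4 * cells - 4 * edges + 4 * Z full.
Proof.
have -> : turning = dsum n.+1 m.+1 (fun i j =>
    2 * (three_of_window i j)%:Z
    + ((g i j + g i j.+1) + (g i.+1 j + g i.+1 j.+1))
    - 2 * (((f i j && f i j.+1)%:Z + (f i.+1 j && f i.+1 j.+1)%:Z)
          + ((f i j && f i.+1 j)%:Z + (f i j.+1 && f i.+1 j.+1)%:Z))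
    + 4 * (full i j)%:Z).
  apply: eq_dsum => i j; rewrite /corners /full /three_of_window /g.
  by move: (f i j) (f i j.+1) (f i.+1 j) (f i.+1 j.+1); do 4!case; vm_compute.
have g10 : dsum n.+1 m.+1 (fun i j => g i.+1 j) = cells.
  by rewrite cellsE; apply: dsum_shift_row => j; rewrite /g f_pad.
have g01 : dsum n.+1 m.+1 (fun i j => g i j.+1) = cells.
  by rewrite cellsE; apply: dsum_shift_col => i; rewrite /g f_pad.
have g11 : dsum n.+1 m.+1 (fun i j => g i.+1 j.+1) = cells.
  rewrite -g01; apply: (@dsum_shift_row _ _ (fun i j => g i j.+1)) => j;
  by rewrite /g f_pad.
have h10 : dsum n.+1 m.+1 (fun i j => (f i.+1 j && f i.+1 j.+1)%:Z)
    = Z (fun i j => f i j && f i j.+1).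
  by apply: (@dsum_shift_row _ _ (fun i j => (f i j && f i j.+1)%:Z)) => j; rewrite f_pad.
have v01 : dsum n.+1 m.+1 (fun i j => (f i j.+1 && f i.+1 j.+1)%:Z)
    = Z (fun i j => f i j && f i.+1 j).
  by apply: (@dsum_shift_col _ _ (fun i j => (f i j && f i.+1 j)%:Z)) => j; rewrite f_pad.
rewrite !(dsumB, dsumD, dsumZ) g10 g01 g11 h10 v01 -cellsE /edges /Z; ring.
Qed.

Definition outer_degree : int := dsum n m (fun i j =>
  (1 - g i.+1 j.+1) * (g i j.+1 + g i.+2 j.+1 + (g i.+1 j + g i.+1 j.+2))).

(** Each of the four shifted sums of [g] misses one extreme row or column, together [border]. Pairs
    with both cells in S are subtracted once from each end. *)
Lemma outer_degreeE : outer_degree = 4 * cells - border - 2 * edges.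
Proof.
have -> : outer_degree = dsum n m (fun i j =>
    (g i j.+1 + g i.+2 j.+1 + (g i.+1 j + g i.+1 j.+2))
    - ((f i j.+1 && f i.+1 j.+1)%:Z + (f i.+1 j.+1 && f i.+2 j.+1)%:Z
       + ((f i.+1 j && f i.+1 j.+1)%:Z + (f i.+1 j.+1 && f i.+1 j.+2)%:Z))).
  apply: eq_dsum => i j; rewrite /g.
  move: (f i.+1 j.+1) (f i j.+1) (f i.+2 j.+1) (f i.+1 j) (f i.+1 j.+2).
  by do 5!case; vm_compute.
rewrite dsumB !dsumD.
have up : cells = dsum n m (fun i j => g i j.+1) + \sum_(0 <= j < m) g n j.+1.
  by rewrite -(dsumSr n m (fun i j => g i j.+1)) dsum_rowl // => j; rewrite /g f_pad.
have down : cells = \sum_(0 <= j < m) g 1 j.+1 + dsum n m (fun i j => g i.+2 j.+1).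
  rewrite -(dsumSl n m (fun i j => g i.+1 j.+1)) dsum_rowr // => j.
  by rewrite /g f_pad.
have left : cells = dsum n m (fun i j => g i.+1 j) + \sum_(0 <= i < n) g i.+1 m.
  by rewrite -(dsum_cSr n m (fun i j => g i.+1 j)) dsum_coll // => j; rewrite /g f_pad.
have right : cells = \sum_(0 <= i < n) g i.+1 1 + dsum n m (fun i j => g i.+1 j.+2).
  rewrite -(dsum_cSl n m (fun i j => g i.+1 j.+1)) dsum_colr // => j.
  by rewrite /g f_pad.
have v1 : Z (fun i j => f i j && f i.+1 j)
    = dsum n m (fun i j => (f i j.+1 && f i.+1 j.+1)%:Z).
  rewrite /Z dsum_rowr; last by move=> j; rewrite f_pad andbF.
  by rewrite dsum_coll // => j; rewrite f_pad.
have v2 : Z (fun i j => f i j && f i.+1 j)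
    = dsum n m (fun i j => (f i.+1 j.+1 && f i.+2 j.+1)%:Z).
  rewrite /Z dsum_rowl; last by move=> j; rewrite f_pad.
  by rewrite dsum_coll // => j; rewrite f_pad.
have h1 : Z (fun i j => f i j && f i j.+1)
    = dsum n m (fun i j => (f i.+1 j && f i.+1 j.+1)%:Z).
  rewrite /Z dsum_rowl; last by move=> j; rewrite f_pad.
  by rewrite dsum_colr // => j; rewrite f_pad andbF.
have h2 : Z (fun i j => f i j && f i j.+1)
    = dsum n m (fun i j => (f i.+1 j.+1 && f i.+1 j.+2)%:Z).
  rewrite /Z dsum_rowl; last by move=> j; rewrite f_pad.
  by rewrite dsum_coll // => j; rewrite f_pad.
rewrite -v1 -v2 -h1 -h2 /border /edges !big_split /=.
move: up down left right; lra.
Qed.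

Hypothesis dominatedP : forall i j, (i < n)%N -> (j < m)%N ->
  [|| f i.+1 j.+1, f i j.+1, f i.+2 j.+1, f i.+1 j | f i.+1 j.+2].

(** Each three-cell window is charged to its missing cell. A missing cell with r such windows has at
    least r + 1 neighbours in S: by domination if r = 0, by inspection if r is 1, 2 or 3. Only a
    hole, with r = 4, falls short, by one. *)
Lemma outer_degree_ge :
  Z three_of_window + ((n * m)%N%:Z - cells) <= outer_degree + Z hole.
Proof.
have -> : Z three_of_window = dsum n m (fun i j =>
    [&& ~~ f i.+1 j.+1, f i.+1 j.+2, f i.+2 j.+1 & f i.+2 j.+2]%:Z
    + [&& ~~ f i.+1 j.+1, f i.+1 j, f i.+2 j & f i.+2 j.+1]%:Z
    + ([&& ~~ f i.+1 j.+1, f i j.+1, f i j.+2 & f i.+1 j.+2]%:Z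
       + [&& ~~ f i.+1 j.+1, f i j, f i j.+1 & f i.+1 j]%:Z)).
  transitivity (dsum n.+1 m.+1 (fun i j =>
    [&& ~~ f i j, f i j.+1, f i.+1 j & f i.+1 j.+1]%:Z
    + [&& ~~ f i j.+1, f i j, f i.+1 j & f i.+1 j.+1]%:Z
    + ([&& ~~ f i.+1 j, f i j, f i j.+1 & f i.+1 j.+1]%:Z
       + [&& ~~ f i.+1 j.+1, f i j, f i j.+1 & f i.+1 j]%:Z))).
    apply: eq_dsum => i j; rewrite /three_of_window.
    by move: (f i j) (f i j.+1) (f i.+1 j) (f i.+1 j.+1); do 4!case; vm_compute.
  (* A padding cell shares each of its windows with another padding cell, so it is never the only
     missing one. *)
  rewrite !dsumD; congr (_ + _ + (_ + _)).
  - by rewrite dsum_rowl ?dsum_coll // => j; rewrite !f_pad ?andbF.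
  - by rewrite dsum_rowl ?dsum_colr // => j; rewrite !f_pad ?andbF.
  - by rewrite dsum_rowr ?dsum_coll // => j; rewrite !f_pad ?andbF.
  - by rewrite dsum_rowr ?dsum_colr // => j; rewrite !f_pad ?andbF.
have -> : Z hole = dsum n m (fun i j => (hole i j)%:Z).
  by rewrite /Z dsum_rowr ?dsum_colr // => j; rewrite /hole ?f_pad ?andbF ?f_pad ?andbF.
have -> : (n * m)%N%:Z - cells = dsum n m (fun i j => 1 - g i.+1 j.+1).
  rewrite dsumB; congr (_ - _); rewrite /dsum.
  rewrite !sumr_const_nat !subn0. by rewrite -mulrnA natz mulnC.
rewrite -!dsumD; apply: ler_dsum => i j /dominatedP dom /dom {dom}.
rewrite /hole /g.
move: (f i.+1 j.+1) (f i j) (f i j.+1) (f i j.+2) (f i.+1 j) (f i.+1 j.+2)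
  (f i.+2 j) (f i.+2 j.+1) (f i.+2 j.+2).
by do 9!case; vm_compute.
Qed.

(** * Variation across the gap between two consecutive rows *)

Definition row_turning i : int := \sum_(0 <= j < m.+1) corners i j.

Lemma turning_rows : turning = \sum_(0 <= i < n.+1) row_turning i.
Proof. by []. Qed.

Lemma row_turning_ge0 i : 0 <= row_turning i.
Proof. by apply: sumr_ge0 => j _; apply: normr_ge0. Qed.

Let D i j := g i j - g i.+1 j.
Let D0 i : D i 0 = 0. Proof. by rewrite /D /g !f_pad. Qed.
Let DM i : D i m.+1 = 0. Proof. by rewrite /D /g !f_pad. Qed.

Lemma f_leM i j : f i j -> (j <= m.+1)%N. Proof. by move=> /fP; lia. Qed.

Lemma row_turning_ge2 i j : f i j != f i.+1 j -> 2 <= row_turning i.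
Proof.
move=> fij; have jM : (j <= m.+1)%N.
  by move: fij; case: (boolP (f i j)) => [/f_leM//|_]; case: (boolP (f i.+1 j)) => [/f_leM|].
have := tv_ge1 (D0 i) (DM i) jM; rewrite -/(row_turning i) /D /g.
by move: fij; case: (f i j) (f i.+1 j) => [] [] //= _; apply: le_trans.
Qed.

Lemma row_turning_ge4 i p q r : (p <= q)%N -> (q <= r)%N -> (r <= m.+1)%N ->
  4 <= `|D i p| + `|D i q - D i p| + `|D i r - D i q| + `|D i r| -> 4 <= row_turning i.
Proof.
by move=> pq qr rm /le_trans; apply; apply: (tv_ge3 (D0 i) (DM i) pq qr rm).
Qed.

Lemma row_eq i : row_turning i < 2 -> forall j, f i j = f i.+1 j.
Proof.
move=> lt2 j; apply/eqP; apply: contraTT lt2 => /row_turning_ge2.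
by rewrite -leNgt.
Qed.

(** If neither row contained the other, [D i] would take both values 1 and -1, hence vary by at
    least 1 + 2 + 1. *)
Lemma row_sub i : row_turning i < 4 ->
  (forall j, f i j -> f i.+1 j) \/ (forall j, f i.+1 j -> f i j).
Proof.
move=> lt4.
have [/existsP[p /andP[fp Nfp]]|] :=
    boolP [exists p : 'I_m.+1, f i p && ~~ f i.+1 p]; last first.
  move=> /existsPn no; left => j fij; have jm : (j < m.+1)%N by have := fP fij; lia.
  by have /= := no (Ordinal jm); rewrite fij /= negbK.
right => q fq; apply: contraTT lt4 => Nfq; rewrite -leNgt.
have pm : (p <= m.+1)%N by apply: f_leM fp.
have qm : (q <= m.+1)%N by apply: f_leM fq.
case: (leqP p q) => [pq|/ltnW qp].
  apply: (row_turning_ge4 (leqnn p) pq qm).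
  by rewrite /D /g fp fq (negPf Nfp) (negPf Nfq).
apply: (row_turning_ge4 (leqnn q) qp pm).
by rewrite /D /g fp fq (negPf Nfp) (negPf Nfq).
Qed.

Lemma dsum_ge_row a b F p : (forall i j, 0 <= F i j) -> (p < a)%N ->
  \sum_(0 <= j < b) F p j <= dsum a b F.
Proof.
move=> F0 pa; have := @sum_ge_seq a (fun i => \sum_(0 <= j < b) F i j) [:: p].
by rewrite big_seq1 /= pa => -> // i; apply: sumr_ge0.
Qed.

(* With t the number of cells in row p: a cell that starts a run contributes two
   vertical sides, any other cell a full window. *)
Lemma repeated_row p : (p <= n)%N -> (forall j, f p j = f p.+1 j) ->
  (forall j, (j < m)%N -> [|| f p j, f p j.+1 | f p j.+2]) ->
  exists t : int, m%:Z <= 3 * t /\ 4 * t <= turning + 4 * Z full.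
Proof.
move=> pn eqp domp.
set rise := \sum_(0 <= j < m.+1) (~~ f p j && f p j.+1)%:Z.
set fall := \sum_(0 <= j < m.+1) (f p j && ~~ f p j.+1)%:Z.
set flat := \sum_(0 <= j < m.+1) (f p j && f p j.+1)%:Z.
set len := \sum_(0 <= j < m) g p j.+1.
have rise_flat : rise + flat = len.
  rewrite -big_split /= big_nat_recr //= f_pad !andbF addr0.
  by apply: eq_bigr => j _; rewrite /g; case: (f p j) (f p j.+1) => [] [].
have fall_flat : fall + flat = len.
  rewrite -big_split /= big_nat_recl //= f_pad !andFb add0r.
  by apply: eq_bigr => j _; rewrite /g; case: (f p j.+1) (f p j.+2) => [] [].
(* Every column is either in the row or just beside an end of one of its runs. *)
have m_le : m%:Z <= len + rise + fall.
  have -> : m%:Z = \sum_(0 <= j < m) 1 by rewrite sumr_const_nat subn0 natz.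
  apply: (@le_trans _ _ (len + \sum_(0 <= j < m) (~~ f p j.+1 && f p j.+2)%:Z
                            + \sum_(0 <= j < m) (f p j && ~~ f p j.+1)%:Z)).
    rewrite -!big_split /= !big_mkord; apply: ler_sum => j _.
    have := domp j (ltn_ord j); rewrite /g.
    by move: (f p j) (f p j.+1) (f p j.+2); do 3!case; vm_compute.
  rewrite /rise big_nat_recl //= /fall big_nat_recr //=.
  by apply: lerD; [apply: lerD; rewrite ?lerDr | rewrite lerDl].
have flat_le : flat <= Z full.
  have -> : flat = \sum_(0 <= j < m.+1) (full p j)%:Z.
    by apply: eq_bigr => j _; rewrite /full -!eqp; case: (f p j) (f p j.+1) => [] [].
  by apply: (@dsum_ge_row _ _ (fun i j => (full i j)%:Z)).
have turn_ge : 2 * (rise + fall) <= turning.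
  rewrite /turning dsum_exchange -big_split mulr_sumr !big_mkord.
  apply: ler_sum => j _; pose E i := g i j.+1 - g i j.
  have E0 : E 0 = 0 by rewrite /E /g !f_pad.
  have EN : E n.+1 = 0 by rewrite /E /g !f_pad.
  have /le_trans := tv_ge1 E0 EN (leqW pn).
  have -> : `|E p| = (~~ f p j && f p j.+1)%:Z + (f p j && ~~ f p j.+1)%:Z.
    by rewrite /E /g; case: (f p j) (f p j.+1) => [] [].
  apply; apply: ler_sum_nat => i _.
  have -> : E i.+1 - E i = - ((g i j.+1 - g i.+1 j.+1) - (g i j - g i.+1 j)).
    by rewrite /E; ring.
  by rewrite normrN.
have flat0 : 0 <= flat by apply: sumr_ge0.
(* Here [rise = fall] is the number of runs, so [m_le] reads m <= 3 rise + flat, and 4 (rise + flat)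
   = 2 (rise + fall) + 4 flat. *)
by exists (rise + flat); split; lra.
Qed.

(** * Turning accumulated over several gaps *)

Hypothesis n_ge4 : (4 <= n)%N.
Hypothesis m_ge4 : (4 <= m)%N.
Hypothesis row_between : forall a b c j k,
  (a < b < c)%N -> f a j -> f c k -> exists l, f b l.

Definition wide := exists t : int, m%:Z <= 3 * t /\ 4 * t <= turning + 4 * Z full.

(** A gap between distinct rows costs at least 2, so a total below 4 leaves two of the three gaps
    trivial. If these are adjacent, three equal rows follow each other and the middle one dominates
    itself. Otherwise the middle gap costs less than 4, so its rows are nested, and the larger one,
    repeated on its far side, dominates itself. *)
Lemma three_gaps i : (i.+2 <= n)%N ->
  wide \/ 4 <= row_turning i + row_turning i.+1 + row_turning i.+2.
Proof.
move=> i2n.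
have [lt4|] := ltP (row_turning i + row_turning i.+1 + row_turning i.+2) 4; last by right.
left; have c0 := row_turning_ge0 i; have c1 := row_turning_ge0 i.+1.
have c2 := row_turning_ge0 i.+2.
have dom1 j : (j < m)%N ->
    [|| f i.+1 j.+1, f i j.+1, f i.+2 j.+1, f i.+1 j | f i.+1 j.+2].
  by apply: dominatedP; lia.
have dom2 j : (j < m)%N ->
    [|| f i.+2 j.+1, f i.+1 j.+1, f i.+3 j.+1, f i.+2 j | f i.+2 j.+2].
  by apply: dominatedP; lia.
have [r1|r1] := ltP (row_turning i.+1) 2.
  have [r0|r0] := ltP (row_turning i) 2.
    apply: (repeated_row (p := i.+1)); [lia | exact: row_eq |].
    move=> j /dom1; rewrite (row_eq r0) (row_eq r1 j.+1).
    by case: (f i.+2 j.+1); rewrite ?orbT.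
  have r2 : row_turning i.+2 < 2 by lia.
  apply: (repeated_row (p := i.+1)); [lia | exact: row_eq |].
  move=> j /dom2; rewrite -(row_eq r2) -!(row_eq r1).
  by case: (f i.+1 j.+1); rewrite ?orbT.
have r0 : row_turning i < 2 by lia.
have r2 : row_turning i.+2 < 2 by lia.
have [sub|sub] : (forall j, f i.+1 j -> f i.+2 j) \/ (forall j, f i.+2 j -> f i.+1 j).
- by apply: row_sub; lia.
- apply: (repeated_row (p := i.+2)); [lia | exact: row_eq |].
  move=> j /dom2; rewrite -(row_eq r2).
  by case: (boolP (f i.+1 j.+1)) => [/sub -> | _]; case: (f i.+2 j.+1); rewrite ?orbT.
- apply: (repeated_row (p := i)); [lia | exact: row_eq |].
  move=> j /dom1; rewrite !(row_eq r0).
  by case: (boolP (f i.+2 j.+1)) => [/sub -> | _]; case: (f i.+1 j.+1); rewrite ?orbT.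
Qed.

(** A nonempty row 1 costs 2 against the padding. If gap 1 costs less than 2, row 2 repeats row 1,
    which must then dominate itself. *)
Lemma first_gaps : [\/ wide, forall j, ~~ f 1 j | 4 <= row_turning 0 + row_turning 1].
Proof.
have [lt4|] := ltP (row_turning 0 + row_turning 1) 4; last by constructor 3.
have [/existsP[j f1j]|/existsPn none] := boolP [exists j : 'I_m.+1, f 1 j]; last first.
  constructor 2 => j; apply/negP => f1j; have jm : (j < m.+1)%N by have := fP f1j; lia.
  by have := none (Ordinal jm); rewrite f1j.
constructor 1; have r0 : 2 <= row_turning 0.
  by apply: (row_turning_ge2 (j := j)); rewrite f1j f_pad.
have r1 : row_turning 1 < 2 by lia.
apply: (repeated_row (p := 1%N)); [lia | exact: row_eq |].
move=> k km; have : (0 < n)%N by lia.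
move=> /dominatedP/(_ km); rewrite f_pad -(row_eq r1).
by case: (f 1 k.+1); rewrite ?orbT.
Qed.

Lemma last_gaps : [\/ wide, forall j, ~~ f n j | 4 <= row_turning n.-1 + row_turning n].
Proof.
have En : n.-1.+1 = n by lia.
have [lt4|] := ltP (row_turning n.-1 + row_turning n) 4; last by constructor 3.
have [/existsP[j fnj]|/existsPn none] := boolP [exists j : 'I_m.+1, f n j]; last first.
  constructor 2 => j; apply/negP => fnj; have jm : (j < m.+1)%N by have := fP fnj; lia.
  by have := none (Ordinal jm); rewrite fnj.
constructor 1; have r0 : 2 <= row_turning n.
  by apply: (row_turning_ge2 (j := j)); rewrite fnj f_pad.
have r1 : row_turning n.-1 < 2 by lia.
have eqr := row_eq r1; rewrite En in eqr.
apply: (repeated_row (p := n.-1)); [lia | by rewrite En |].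
move=> k km; have : (n.-1 < n)%N by lia.
move=> /dominatedP/(_ km); rewrite En f_pad !eqr.
by case: (f n k.+1); rewrite ?orbT.
Qed.

Lemma last_two_gaps :
  \sum_(n.-1 <= i < n.+1) row_turning i = row_turning n.-1 + row_turning n.
Proof.
have n0 : (0 < n)%N by lia.
by rewrite big_nat_recr ?leq_pred //= -[X in \sum_(_ <= i < X) _](prednK n0) big_nat1.
Qed.

Lemma gap_blocks a q :
  (forall i, (i.+2 <= n)%N -> 4 <= row_turning i + row_turning i.+1 + row_turning i.+2) ->
  (a + 3 * q <= n.+1)%N ->
  4 * q%:Z <= \sum_(a <= i < a + 3 * q) row_turning i.
Proof.
move=> three; elim: q => [|q IHq] le; first by rewrite muln0 addn0 big_geq.
have -> : (a + 3 * q.+1 = (a + 3 * q).+3)%N by lia.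
rewrite !big_nat_recr /=; try lia.
have i2n : ((a + 3 * q).+2 <= n)%N by lia.
have lele : (a + 3 * q <= n.+1)%N by lia.
by have := three _ i2n; have := IHq lele; rewrite intS; lra.
Qed.

(** * Border sides and the combined turning bound *)

Lemma sum_ge_ends k (F : nat -> int) : (4 <= k)%N -> (forall j, 0 <= F j) ->
  F 0%N + F 1%N + F k.-2 + F k.-1 <= \sum_(0 <= j < k) F j.
Proof.
move=> k4 F0; have := @sum_ge_seq k F [:: 0%N; 1%N; k.-2; k.-1] F0.
rewrite !big_cons big_nil addr0 !addrA; apply; rewrite /= ?inE; lia.
Qed.

Let g01 i j : 0 <= g i j. Proof. by []. Qed.

Lemma border_ge4 : 4 <= border.
Proof.
rewrite /border !big_split /=.
have := sum_ge_ends m_ge4 (fun j => g01 1 j.+1).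
have := sum_ge_ends m_ge4 (fun j => g01 n j.+1).
have := sum_ge_ends n_ge4 (fun i => g01 i.+1 1).
have := sum_ge_ends n_ge4 (fun i => g01 i.+1 m).
have [Em1 Em2] : m.-1.+1 = m /\ m.-2.+1 = m.-1 by lia.
have [En1 En2] : n.-1.+1 = n /\ n.-2.+1 = n.-1 by lia.
rewrite Em1 Em2 En1 En2.
(* [a] stands for a corner cell, counted on both of its border sides, and [b], [c] for its two
   neighbours. *)
have corner (a b c : bool) : [|| a, b | c] -> 1 <= a%:Z + a%:Z + b%:Z + c%:Z.
  by case: a b c => [] [] [].
have /corner : [|| f 1 1, f 1 2 | f 2 1].
  have := @dominatedP 0 0; rewrite !f_pad /= => dom.
  by rewrite orbCA orbC -orbA; apply: dom; lia.
have /corner : [|| f 1 m, f 2 m | f 1 m.-1].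
  have := @dominatedP 0 m.-1; rewrite Em1 !f_pad /= orbF; apply; lia.
have /corner : [|| f n 1, f n.-1 1 | f n 2].
  have := @dominatedP n.-1 0; rewrite En1 !f_pad /=; apply; lia.
have /corner : [|| f n m, f n.-1 m | f n m.-1].
  have := @dominatedP n.-1 m.-1; rewrite En1 Em1 !f_pad /= orbF; apply; lia.
rewrite /g; lra.
Qed.

(* Needed only for n = 1 mod 3 with empty first and last rows, where row 2 is full
   and cell (3, 1) or (3, m) lies in S. *)
Lemma border_ge5 : (7 <= n)%N -> f 2 1 -> f 2 m -> f n.-1 1 -> f n.-1 m ->
  f 3 1 || f 3 m -> 5 <= border.
Proof.
move=> n7 f21 f2m fn1 fnm f3; rewrite /border !big_split /=.
have col k : \sum_(j <- [:: 1; 2; n.-2]%N) g j.+1 k <= \sum_(0 <= j < n) g j.+1 k.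
  by apply: sum_ge_seq; rewrite //= ?inE; lia.
have En2 : n.-2.+1 = n.-1 by lia.
have row i : 0 <= \sum_(0 <= j < m) g i j.+1 by apply: sumr_ge0.
have := col 1%N; have := col m; have := row 1%N; have := row n.
rewrite !big_cons !big_nil En2 /g f21 f2m fn1 fnm addr0.
have : 1 <= (f 3 1)%:Z + (f 3 m)%:Z by move: f3; case: (f 3 1) (f 3 m) => [] [].
rewrite /=; lra.
Qed.

(** Empty rows 1 and n force rows 2 and n - 1 to be full. Unless rows 2 and 3 agree, gaps 1, 2 and n
    - 1 cost at least 2 each, and the 3 (q - 1) gaps from 3 to n - 2 cost 4 (q - 1). The missing 2
    comes from a fifth border side or from gap 2 costing 4. *)
Lemma empty_ends_bound q : n = (3 * q + 1)%N ->
  (forall i, (i.+2 <= n)%N -> 4 <= row_turning i + row_turning i.+1 + row_turning i.+2) ->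
  (forall j, ~~ f 1 j) -> (forall j, ~~ f n j) ->
  wide \/ 4 * (q%:Z + 1) + 8 <= turning + 2 * border.
Proof.
move=> En three none1 nonen.
have Em : m.-1.+1 = m by lia.
have Enn : n.-1.+1 = n by lia.
have full2 j : (j < m)%N -> f 2 j.+1.
  move=> jm; have n0 : (0 < n)%N by lia.
  by have := dominatedP n0 jm; rewrite !f_pad !(negPf (none1 _)) /= !orbF.
have fulln j : (j < m)%N -> f n.-1 j.+1.
  move=> jm; have nn : (n.-1 < n)%N by lia.
  by have := dominatedP nn jm; rewrite Enn !f_pad !(negPf (nonen _)) /= !orbF.
have wide2 : (forall j, f 2 j = f 3 j) -> wide.
  move=> eq2; apply: (repeated_row (p := 2%N)) => //; first by lia.
  by move=> j jm; rewrite (full2 j jm) orbT.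
have [n4|n7] : n = 4%N \/ (7 <= n)%N by lia.
  left; apply: wide2 => j; have [jm|jm] := boolP (0 < j <= m)%N.
    have [Ej jm1] : j = j.-1.+1 /\ (j.-1 < m)%N by lia.
    by rewrite Ej full2 //; have := fulln _ jm1; rewrite n4 => ->.
  by apply/idP/idP => /fP; rewrite (negPf jm) andbF.
have [r2|r2] := ltP (row_turning 2) 2; first by left; apply/wide2/row_eq.
right; have m0 : (0 < m)%N by lia.
have m1 : (m.-1 < m)%N by lia.
have f21 := full2 _ m0; have f2m := full2 _ m1; rewrite Em in f2m.
have fn1 := fulln _ m0; have fnm := fulln _ m1; rewrite Em in fnm.
have r1 : 2 <= row_turning 1.
  by apply: (row_turning_ge2 (j := 1%N)); rewrite f21 (negPf (none1 _)).
have rn : 2 <= row_turning n.-1.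
  by apply: (row_turning_ge2 (j := 1%N)); rewrite fn1 Enn (negPf (nonen _)).
have turn : 4 * (q%:Z - 1) + row_turning 1 + row_turning 2 + row_turning n.-1 <= turning.
  have [p Ep] : exists p, q = p.+1 by exists q.-1; lia.
  have le : (3 + 3 * p <= n.+1)%N by lia.
  have blocks := gap_blocks three le.
  rewrite (_ : 3 + 3 * p = n.-1)%N in blocks; last lia.
  rewrite turning_rows [leRHS](big_cat_nat (n := 3%N)) //=; last lia.
  rewrite [X in _ <= _ + X](big_cat_nat (n := n.-1)) /=; try lia.
  rewrite last_two_gaps !big_nat_recl // big_geq //.
  have := row_turning_ge0 0; have := row_turning_ge0 n; rewrite Ep intS; move: blocks; lra.
have b4 := border_ge4.
have [f3|] := boolP (f 3 1 || f 3 m).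
  by have := border_ge5 n7 f21 f2m fn1 fnm f3; lra.
rewrite negb_or => /andP[f31 f3m].
have lt23 : (2 < 3 < n.-1)%N by lia.
have [l f3l] := row_between lt23 f21 fn1.
have /andP[_ lm] := fP f3l.
have [l0 l1] : (0 < l)%N /\ (l.-1 < m)%N by move: lm; clear; lia.
have f2l : f 2 l by have := full2 l.-1 l1; rewrite prednK.
(* Connectedness makes row 3 meet S in some column l, while it misses columns 1 and m: [D 2] is 1,
   0, 1 at columns 1, l, m. *)
suff : 4 <= row_turning 2 by lra.
apply: (@row_turning_ge4 2 1 l m) => //; first by case/andP: lm.
by rewrite /D /g f21 f2l f2m f3l (negPf f31) (negPf f3m).
Qed.

(** Outside the [wide] case the n + 1 gaps are grouped in triples. For n = 3 q or 3 q + 2 this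
    suffices; for n = 3 q + 1 two gaps are left over, and they are chosen at the top or at the
    bottom, where a nonempty end row makes the pair cost 4. *)
Lemma turning_bound :
  exists t : int, (minn m n)%:Z <= 3 * t /\ 4 * t + 8 <= turning + 4 * Z full + 2 * border.
Proof.
have b4 := border_ge4.
have full0 : 0 <= Z full by apply: sumr_ge0 => i _; apply: sumr_ge0.
suff [[t [mt tt]]|[t [nt tt]]] : wide \/
    exists t : int, n%:Z <= 3 * t /\ 4 * t + 8 <= turning + 2 * border.
- by exists t; split; [apply: le_trans mt; rewrite lez_nat geq_minl | lra].
- by exists t; split; [apply: le_trans nt; rewrite lez_nat geq_minr | lra].
have [three|three] : wide \/ forall i, (i.+2 <= n)%N ->
    4 <= row_turning i + row_turning i.+1 + row_turning i.+2.
- have [/existsP[i]|/existsPn no] := boolP [exists i : 'I_n,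
      (i.+2 <= n)%N && (row_turning i + row_turning i.+1 + row_turning i.+2 < 4)].
    by move=> /andP[/three_gaps[]]; [left | lia].
  right => i i2n; have ltin : (i < n)%N by lia.
  by have := no (Ordinal ltin); rewrite /= i2n -leNgt.
- by left.
have sum0 a b : 0 <= \sum_(a <= i < b) row_turning i.
  by apply: sumr_ge0 => i _; apply: row_turning_ge0.
have split_at a : (a <= n.+1)%N ->
    turning = \sum_(0 <= i < a) row_turning i + \sum_(a <= i < n.+1) row_turning i.
  by move=> an; rewrite turning_rows (big_cat_nat (n := a)).
have [q En] : exists q, n \in [:: 3 * q; 3 * q + 1; 3 * q + 2]%N.
  by exists (n %/ 3)%N; rewrite !inE; lia.
move: En; rewrite !inE => /or3P[] /eqP En.
- right; exists q%:Z; split; first by lia.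
  have le : (0 + 3 * q <= n.+1)%N by lia.
  have := gap_blocks three le; have := split_at _ le; have := sum0 (0 + 3 * q)%N n.+1.
  lra.
- have [| none1 | top] := first_gaps; first by left.
    have [| nonen | bot] := last_gaps; first by left.
      have [|le] := empty_ends_bound En three none1 nonen; first by left.
      by right; exists (q%:Z + 1); split; first lia.
    right; exists (q%:Z + 1); split; first by lia.
    have le : (0 + 3 * q <= n.+1)%N by lia.
    have := gap_blocks three le; have := split_at _ le.
    have -> : \sum_(0 + 3 * q <= i < n.+1) row_turning i = row_turning n.-1 + row_turning n.
      by rewrite (_ : 0 + 3 * q = n.-1)%N; [exact: last_two_gaps | lia].
    lra.
  right; exists (q%:Z + 1); split; first by lia.
  have le : (2 + 3 * q <= n.+1)%N by lia.
  have le2 : (2 <= n.+1)%N by lia.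
  have := gap_blocks three le; have := split_at _ le2.
  have -> : (2 + 3 * q = n.+1)%N by lia.
  have -> : \sum_(0 <= i < 2) row_turning i = row_turning 0 + row_turning 1.
    by rewrite !big_nat_recl //= big_geq // addr0.
  lra.
- right; exists (q%:Z + 1); split; first by lia.
  have le : (0 + 3 * q.+1 <= n.+1)%N by lia.
  have := gap_blocks three le; have := split_at _ le; have := sum0 (0 + 3 * q.+1)%N n.+1.
  rewrite intS; lra.
Qed.

Lemma cells_bound : cells + Z full + Z hole <= 1 + edges ->
  exists t : int, (minn m n)%:Z <= 3 * t /\ (n * m)%N%:Z + 2 * t <= 3 * cells.
Proof.
move=> acyclic; have [t [mint tt]] := turning_bound; exists t; split=> //.
have hole0 : 0 <= Z hole by apply: sumr_ge0 => i _; apply: sumr_ge0.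
(* Eliminating the three-cell windows and bounding [edges] by [acyclic] cancels [border] and
   [Z full]; what remains is 4 t <= 6 cells - 2 n m - 6 holes. *)
have := turningE; have := outer_degreeE; have := outer_degree_ge; lra.
Qed.

(* Horizontal edges that remain after discarding the top edge of every full window
   and the top left edge of the ring around every hole. *)
Definition kept i j := [&& f i j, f i j.+1, ~~ (f i.+1 j && f i.+1 j.+1) & ~~ hole i j].

(** No edge is discarded twice: the window below the top left edge of a ring contains the missing
    centre, so it is not full. *)
Lemma kept_edges :
  dsum n m (fun i j => (f i.+1 j.+1 && f i.+2 j.+1)%:Z + (kept i.+1 j.+1)%:Z)
  = edges - Z full - Z hole.
Proof.
have -> : dsum n m (fun i j => (f i.+1 j.+1 && f i.+2 j.+1)%:Z + (kept i.+1 j.+1)%:Z)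
    = dsum n.+1 m.+1 (fun i j => (f i j && f i.+1 j)%:Z + (kept i j)%:Z).
  by rewrite dsum_rowl ?dsum_coll // => k; rewrite /kept !f_pad.
have -> : edges = Z (fun i j => f i j && f i.+1 j) + Z (fun i j => f i j && f i j.+1).
  by rewrite addrC.
rewrite dsumD -!addrA; congr (_ + _); rewrite addrA -!dsumB.
apply: eq_dsum => i j; rewrite /kept /full /hole.
move: (f i.+1 j.+1) (f i j) (f i j.+1) (f i j.+2) (f i.+1 j) (f i.+1 j.+2)
  (f i.+2 j) (f i.+2 j.+1) (f i.+2 j.+2).
by do 9!case; vm_compute.
Qed.

End PaddedGrid.

(** * Edge count of a connected graph *)

Lemma connected_edge_count (V E : finType) (src dst : E -> V) (F : {set E})
    (S : {set V}) (x0 : V) :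
  (forall y, y \in S -> connect [rel x y | [exists e in F,
     (src e == x) && (dst e == y) || (src e == y) && (dst e == x)]] x0 y) ->
  (#|S| <= #|F|.+1)%N.
Proof.
move=> conn; pose inside (A : {set V}) := [set e in F | (src e \in A) && (dst e \in A)].
pose P (A : {set V}) := (x0 \in A) && (#|A| <= #|inside A|.+1)%N.
have P0 : P [set x0] by rewrite /P set11 cards1.
(* An edge leaving a maximal such [B] would let its far end join, adding one vertex and at least one
   inner edge; so [B] is closed under adjacency and contains [S]. *)
have [B /maxsetP[/andP[x0B cardB] maxB] _] := maxset_exists P0.
have grow e z : e \in F -> z \notin B ->
    src e \in z |: B -> dst e \in z |: B -> (src e \in B) && (dst e \in B) = false -> False.
  move=> eF zB sB dB out; suff /maxB : P (z |: B).
    by move=> eqB; case/negP: zB; rewrite -(eqB (subsetUr _ _)) setU11.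
  rewrite /P inE x0B orbT cardsU1 zB add1n ltnS /=; apply: leq_trans cardB _.
  have <- : #|e |: inside B| = #|inside B|.+1 by rewrite cardsU1 !inE out andbF.
  apply/subset_leq_card/subsetP => e'; rewrite !inE => /orP[/eqP->|].
    by rewrite eF; move: sB dB; rewrite !inE => -> ->.
  by move=> /and3P[-> -> ->]; rewrite !orbT.
have closedB : closed [rel x y | [exists e in F,
    (src e == x) && (dst e == y) || (src e == y) && (dst e == x)]] (mem B).
  have step e : e \in F -> (src e \in B) = (dst e \in B).
    move=> eF; apply/idP/idP => inB; apply/negPn/negP => out.
      by apply: (grow e (dst e)); rewrite // ?setU11 ?inE ?inB ?orbT // (negPf out).
    by apply: (grow e (src e)); rewrite // ?setU11 ?inE ?inB ?orbT // (negPf out).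
  move=> x y /exists_inP[e /step st /orP[] /andP[/eqP <- /eqP <-]]; first exact: st.
  by rewrite st.
have SB : S \subset B.
  by apply/subsetP => y /conn /(closed_connect closedB) <-.
apply: leq_trans (subset_leq_card SB) (leq_trans cardB _); rewrite ltnS.
by apply: subset_leq_card; apply/subsetP => e; rewrite inE => /andP[].
Qed.

(** * From the grid graph to the padded indicator *)

Lemma dsum_card n m (P : nat -> nat -> bool) :
  dsum n m (fun i j => (P i j)%:Z) = #|[set x : 'I_n * 'I_m | P x.1 x.2]|%:Z.
Proof.
transitivity (\sum_(i < n) \sum_(j < m) (P i j)%:Z).
  by rewrite /dsum big_mkord; apply: eq_bigr => i _; rewrite big_mkord.
rewrite pair_bigA /= -[RHS]natz -sum1_card natr_sum [RHS]big_mkcond /=.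
by apply: eq_bigr => x _; rewrite inE; case: (P _ _).
Qed.

Lemma grid_cases n m (x y : 'I_n * 'I_m) : @grid n m x y ->
  [\/ x.1 = y.1 /\ x.2.+1 = y.2 :> nat, x.1 = y.1 /\ y.2.+1 = x.2 :> nat,
      x.2 = y.2 /\ x.1.+1 = y.1 :> nat | x.2 = y.2 /\ y.1.+1 = x.1 :> nat].
Proof.
case: x y => [[a ha] [b hb]] [[c hc] [d hd]]; rewrite /grid /= => /eqP e.
have [[e1 e2]|[[e1 e2]|[[e1 e2]|[e1 e2]]]] : (a = c /\ b.+1 = d) \/ (a = c /\ d.+1 = b)
   \/ (b = d /\ a.+1 = c) \/ (b = d /\ c.+1 = a) by lia.
- by constructor 1; split=> //; apply: val_inj.
- by constructor 2; split=> //; apply: val_inj.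
- by constructor 3; split=> //; apply: val_inj.
- by constructor 4; split=> //; apply: val_inj.
Qed.

Section Cells.
Variables (n m : nat) (S : {set 'I_n * 'I_m}).

Definition cell i j := [exists x in S, (x.1.+1 == i) && (x.2.+1 == j)].

Lemma cellE (x : 'I_n * 'I_m) : cell x.1.+1 x.2.+1 = (x \in S).
Proof.
apply/exists_inP/idP => [[y yS /andP[/eqP[e1] /eqP[e2]]]|xS]; last first.
  by exists x; rewrite ?eqxx.
by rewrite (_ : x = y) //; case: x y e1 e2 yS => [? ?] [? ?] /= /val_inj-> /val_inj->.
Qed.

Lemma cellP i j : cell i j -> (0 < i <= n)%N && (0 < j <= m)%N.
Proof. by case/exists_inP=> x _ /andP[/eqP<- /eqP<-]; rewrite !ltn_ord. Qed.

Lemma cells_card : cells n m cell = #|S|%:Z.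
Proof.
rewrite /cells (dsum_card n m (fun i j => cell i.+1 j.+1)); congr (Posz #|pred_of_set _|).
by apply/setP => x; rewrite inE cellE.
Qed.

Lemma cell_dominated i j : dominating (@grid n m) S -> (i < n)%N -> (j < m)%N ->
  [|| cell i.+1 j.+1, cell i j.+1, cell i.+2 j.+1, cell i.+1 j | cell i.+1 j.+2].
Proof.
move=> /forallP dom lin ljm; have := dom (Ordinal lin, Ordinal ljm).
case/orP => [|/exists_inP[y]]; first by rewrite -cellE => ->.
rewrite -cellE => yS /grid_cases[] /= [e1 e2]; move: yS.
- by rewrite -e1 -e2 => ->; rewrite !orbT.
- by rewrite -e1 e2 => ->; rewrite !orbT.
- by rewrite -e1 -e2 => ->; rewrite !orbT.
- by rewrite -e1 e2 => ->; rewrite !orbT.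
Qed.

Hypothesis connS : induced_connected (@grid n m) S.

(** An edge changes the row by at most one, so if row b were empty the part of S above it would be
    closed under adjacency. *)
Lemma cell_between a b c j k : (a < b < c)%N -> cell a j -> cell c k -> exists l, cell b l.
Proof.
move=> abc /exists_inP[x xS /andP[/eqP xa _]] /exists_inP[y yS /andP[/eqP yc _]].
have [/existsP[l bl]|/existsPn none] := boolP [exists l : 'I_m, cell b l.+1].
  by exists l.+1.
have notb z : z \in S -> z.1.+1 <> b.
  by move=> zS zb; have := none z.2; rewrite -zb cellE zS.
have /forall_inP/(_ x xS)/forall_inP/(_ y yS) := connS.
have cl : closed (induced (@grid n m) S) [pred z : 'I_n * 'I_m | (z.1.+1 < b)%N].
  move=> u v /and3P[/notb ub /notb vb /grid_cases uv]; rewrite !inE.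
  by apply/idP/idP; case: uv => [] [e1 e2]; move: ub vb; rewrite ?e1 -?e2; lia.
move/(closed_connect cl); rewrite !inE xa yc.
by case/andP: abc => -> /ltnW; rewrite leqNgt => /negPf->.
Qed.


(** * The graph of kept edges is connected *)

Let src (e : 'I_n * 'I_m * bool) := e.1.
(** The boolean marks vertical edges. [ordS] wraps around at the last row or column, but edges in
    [kept_set] end at a cell of the grid and never wrap. *)
Let dst (e : 'I_n * 'I_m * bool) : 'I_n * 'I_m :=
  if e.2 then (ordS e.1.1, e.1.2) else (e.1.1, ordS e.1.2).
Let kept_set : {set 'I_n * 'I_m * bool} := [set e : 'I_n * 'I_m * bool |
  if e.2 then cell e.1.1.+1 e.1.2.+1 && cell e.1.1.+2 e.1.2.+1
  else kept cell e.1.1.+1 e.1.2.+1].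
Let adj := [rel x y : 'I_n * 'I_m | [exists e in kept_set,
  (src e == x) && (dst e == y) || (src e == y) && (dst e == x)]].

Lemma kept_set_card :
  #|kept_set|%:Z = edges n m cell - dsum n.+1 m.+1 (fun i j => (full cell i j)%:Z)
                   - dsum n.+1 m.+1 (fun i j => (hole cell i j)%:Z).
Proof.
rewrite -(kept_edges cellP) dsumD.
rewrite (dsum_card n m (fun i j => cell i.+1 j.+1 && cell i.+2 j.+1)).
rewrite (dsum_card n m (fun i j => kept cell i.+1 j.+1)) -PoszD; congr Posz.
transitivity (\sum_(x : 'I_n * 'I_m) \sum_(b : bool) ((x, b) \in kept_set))%N.
  rewrite pair_bigA -sum1_card [LHS]big_mkcond /=.
  by apply: eq_bigr => -[x b] _; case: (_ \in _).
rewrite -!sum1_card [X in (_ = X + _)%N]big_mkcond [X in (_ = _ + X)%N]big_mkcond.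
rewrite -big_split /=.
apply: eq_bigr => x _; rewrite big_bool !inE /=.
by case: (_ && _) (kept _ _ _) => [] [].
Qed.

Let adj_sym : symmetric adj.
Proof. by move=> x y; apply: eq_existsb => e; rewrite orbC. Qed.

Variable x0 : 'I_n * 'I_m.
Let pt i j : 'I_n * 'I_m := (insubd x0.1 i.-1, insubd x0.2 j.-1).

Lemma pt_val i j : cell i j -> (pt i j).1.+1 = i /\ (pt i j).2.+1 = j.
Proof.
move/cellP => /andP[/andP[i0 i1] /andP[j0 j1]].
by rewrite /= !val_insubd !prednK // i1 j1 !prednK.
Qed.

Lemma pt_eq i j (x : 'I_n * 'I_m) : cell i j -> x.1.+1 = i -> x.2.+1 = j -> x = pt i j.
Proof.
by move=> /pt_val[]; case: x (pt i j) => [a b] [c d] /= <- <- [/val_inj->] [/val_inj->].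
Qed.

Lemma adj_down i j : cell i j -> cell i.+1 j -> connect adj (pt i j) (pt i.+1 j).
Proof.
move=> cij cij'; apply: connect1; apply/exists_inP.
have [e1 e2] := pt_val cij; have /andP[/andP[_ ln] _] := cellP cij'.
exists (pt i j, true); first by rewrite inE /= e1 e2 cij.
rewrite eqxx /=; apply/orP; left; apply/eqP; apply: pt_eq => //=.
by rewrite modn_small e1.
Qed.

Lemma adj_right i j : kept cell i j -> connect adj (pt i j) (pt i j.+1).
Proof.
move=> kij; have /and4P[cij cij' _ _] := kij; apply: connect1; apply/exists_inP.
have [e1 e2] := pt_val cij; have /andP[_ /andP[_ lm]] := cellP cij'.
exists (pt i j, false); first by rewrite inE /= e1 e2.
rewrite eqxx /=; apply/orP; left; apply/eqP; apply: pt_eq => //=.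
by rewrite modn_small e2.
Qed.

Let adj_connC : connect_sym adj. Proof. exact: sym_connect_sym. Qed.

(* A discarded edge is bypassed around its full window or its hole, which only uses
   horizontal edges further down, apart from the top right edge of the ring around
   the hole, which is never discarded. *)
Lemma adj_row i j : cell i j -> cell i j.+1 -> connect adj (pt i j) (pt i j.+1).
Proof.
(* Induction from the bottom row upwards: [k] bounds the number of rows left, and for [k = 0] row i
   lies beyond the grid. *)
have [k] : exists k, (n < i + k)%N by exists n.+1; lia.
elim: k {-2}k (leqnn k) i j => [|k IHk] l lk i j nil c00 c01.
  by have := cellP c00; lia.
have down i' j' : (i < i')%N -> cell i' j' -> cell i' j'.+1 ->
    connect adj (pt i' j') (pt i' j'.+1).
  by move=> lt; apply: (IHk k) => //; lia.
have [kij|] := boolP (kept cell i j); first exact: adj_right.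
rewrite /kept c00 c01 /= negb_and !negbK.
case: (boolP (cell i.+1 j && _)) => [/andP[c10 c11] _|_].
  apply: connect_trans (adj_down c00 c10) _.
  apply: connect_trans (down _ _ (leqnn _) c10 c11) _.
  by rewrite adj_connC; apply: adj_down.
case/and5P => N11 _ _ c02 /and5P[c10 c12 c20 c21 c22].
apply: connect_trans (adj_down c00 c10) _.
apply: connect_trans (adj_down c10 c20) _.
apply: connect_trans (down _ _ (leqnSn _) c20 c21) _.
apply: connect_trans (down _ _ (leqnSn _) c21 c22) _.
rewrite adj_connC; apply: (@connect_trans _ _ (pt i j.+2)).
  (* The window below this edge contains the missing centre, and the cell that would be the centre
     of its own hole lies in S. *)
  by apply: adj_right; rewrite /kept /hole c01 c02 (negPf N11) c12.
exact: connect_trans (adj_down c02 c12) (adj_down c12 c22).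
Qed.

Lemma adj_connected : x0 \in S -> forall y, y \in S -> connect adj x0 y.
Proof.
move=> x0S y yS; have /forall_inP/(_ _ x0S)/forall_inP/(_ _ yS) := connS.
apply: connect_sub => {yS} {}y z /and3P[].
have ptE x : x \in S -> x = pt x.1.+1 x.2.+1.
  by move=> xS; apply: pt_eq; rewrite ?cellE.
rewrite -!cellE => yS zS yz; rewrite [y]ptE -?cellE // [z]ptE -?cellE //.
case: (grid_cases yz) => [] [e1 e2].
- by rewrite -e1 -e2; apply: adj_row => //; rewrite e1 e2.
- by rewrite adj_connC e1 -e2; apply: adj_row => //; rewrite -?e1 ?e2.
- by rewrite -e1 -e2; apply: adj_down => //; rewrite e1 e2.
- by rewrite adj_connC e1 -e2; apply: adj_down => //; rewrite -?e1 ?e2.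
Qed.

Lemma cells_acyclic : x0 \in S ->
  cells n m cell + dsum n.+1 m.+1 (fun i j => (full cell i j)%:Z)
    + dsum n.+1 m.+1 (fun i j => (hole cell i j)%:Z) <= 1 + edges n m cell.
Proof.
move=> x0S; have := connected_edge_count (adj_connected x0S).
rewrite -lez_nat intS kept_set_card -cells_card; lra.
Qed.

End Cells.

(** * The bound on sizes and on the domination number *)

Lemma connected_dominating_card n m (S : {set 'I_n * 'I_m}) :
  (4 <= n)%N -> (4 <= m)%N -> connected_dominating (@grid n m) S ->
  exists t : int, (minn m n)%:Z <= 3 * t /\ (n * m)%N%:Z + 2 * t <= 3 * #|S|%:Z.
Proof.
move=> n4 m4 /andP[conn dom].
have [x0 x0S] : exists x, x \in S.
  have n0 : (0 < n)%N by lia.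
  have m0 : (0 < m)%N by lia.
  have /forallP/(_ (Ordinal n0, Ordinal m0)) := dom.
  by case/orP => [x0S|/exists_inP[x0 x0S _]]; [exists (Ordinal n0, Ordinal m0) | exists x0].
rewrite -cells_card; apply: (cells_bound (f := cell S)) => //.
- exact: cellP.
- by move=> i j; apply: cell_dominated.
- exact: cell_between.
- exact: cells_acyclic x0S.
Qed.

Theorem theorem3 (m n : nat) (hm : (4 <= m)%N) (hn : (4 <= n)%N) :
  let bound : int :=
    Num.ceil (((m * n)%N%:R
               + 2%:R * (Num.ceil ((minn m n)%:R / 3%:R : rat))%:~R) / 3%:R : rat) in
  (forall S : {set 'I_n * 'I_m},
     connected_dominating (@grid n m) S -> bound <= #|S|%:Z)
  /\ bound <= (connected_domination_number (@grid n m))%:Z.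
Proof.
move=> bound.
(* An integer t with min(m, n) <= 3 t is at least the inner ceiling, and the outer ceiling is
   removed because k is an integer. *)
have bound_le (t : int) (k : nat) :
    (minn m n)%:Z <= 3 * t -> (n * m)%N%:Z + 2 * t <= 3 * k%:Z -> bound <= k%:Z.
  move=> mint tk; rewrite /bound ceil_le_int ler_pdivrMr //.
  have ct : Num.ceil ((minn m n)%:R / 3%:R : rat) <= t.
    rewrite ceil_le_int ler_pdivrMr //.
    by rewrite -[_%:R]/((minn m n)%:Z%:~R) -[3%:R]/(3%:~R) -intrM ler_int mulrC.
  rewrite -[_%:R]/((m * n)%N%:Z%:~R) -[2%:R]/(2%:~R) -[3%:R]/(3%:~R) -!(intrM, intrD) ler_int.
  by rewrite (mulnC m); lra.
have main (S : {set 'I_n * 'I_m}) : connected_dominating (@grid n m) S -> bound <= #|S|%:Z.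
  by case/(connected_dominating_card hn hm) => t []; apply: bound_le.
split=> //; rewrite /connected_domination_number.
apply: (big_ind (fun k : nat => bound <= k%:Z)) => //.
(* The default value n m of the minimum also satisfies the bound: take t = min(m, n), which is at
   most n m. *)
- rewrite card_prod !card_ord; apply: (bound_le (minn m n)%:Z); first lia.
  nia.
- by move=> k l bk bl; rewrite /minn; case: ifP.
Qed.
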